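(* $$\sum_{r=0}^{\infty}\omega_{n,r}(x)\,t^{r}=\frac{t}{1-t}\,\omega_{n}\!\left(\frac{x}{1-t}\right).$$
   Context: $S(n,k)$ denotes the Stirling numbers of the second kind. For $n=0,1,2,\dots$ the geometric polynomials are $\omega_{n,r}(x)=\sum_{k=0}^{n}S(n,k)\,(r)_k\,x^{k}$, where $(r)_k=r(r+1)\cdots(r+k-1)$, $(r)_0=1$ (so $\omega_{n,0}(x)=\delta_{n,0}$), and $\omega_n(x)=\omega_{n,1}(x)=\sum_{k=0}^{n}S(n,k)\,k!\,x^{k}$. The identity is the ordinary generating function of $\omega_{n,r}(x)$ with respect to the parameter $r$, with $t$ the generating variable.
   Formalization: The identity is proved for n ≥ 1 only; at n = 0 it fails, since ω_{0,r}(x) = 1 for every r makes the left side 1/(1-t) while the right side is t/(1-t). *)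

(* Defs.v *)
From HB Require Import structures.
From mathcomp Require Import all_boot all_order all_algebra.
From mathcomp Require Import boolp.
From mathcomp Require classical_sets.

Set Implicit Arguments.
Unset Strict Implicit.
Unset Printing Implicit Defensive.

Import Order.TTheory GRing.Theory Num.Theory.

Local Open Scope ring_scope.

(* Number of partitions of an n-element set into k nonempty blocks: [partition]
   requires its blocks to be nonempty. *)
Definition stirling2 (n k : nat) : nat :=
  #|[set P : {set {set 'I_n}} | partition P [set: 'I_n] & #|P| == k]|.

Definition rising_fact (r k : nat) : nat := (\prod_(i < k) (r + i))%N.

Lemma rising_fact1 k : rising_fact 1 k = k`!.
Proof.
elim: k => [|k IHk]; first by rewrite /rising_fact big_ord0.
by rewrite /rising_fact big_ord_recr /= -/(rising_fact 1 k) IHk add1n factS mulnC.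
Qed.

Section GeometricPolynomials.
Variable A : nzRingType.

Definition geom_poly (n r : nat) : {poly A} :=
  \poly_(k < n.+1) (stirling2 n k * rising_fact r k)%:R.

Definition omega (n : nat) : {poly A} := geom_poly n 1.

Lemma geom_polyE n r (x : A) :
  (geom_poly n r).[x] =
  \sum_(0 <= k < n.+1) (stirling2 n k)%:R * (rising_fact r k)%:R * x ^+ k.
Proof. by rewrite horner_poly big_mkord; apply: eq_bigr => k _; rewrite natrM. Qed.

Lemma omegaE n (x : A) :
  (omega n).[x] = \sum_(0 <= k < n.+1) (stirling2 n k)%:R * k`!%:R * x ^+ k.
Proof. by rewrite geom_polyE; apply: eq_bigr => k _; rewrite rising_fact1. Qed.

End GeometricPolynomials.

(* The ring A[[t]].  A record rather than a bare [nat -> A], whose canonical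
   ring structure is the pointwise one. *)
Record fps (A : Type) := Fps { fps_coef : nat -> A }.

HB.instance Definition _ (A : Type) := gen_eqMixin (fps A).
HB.instance Definition _ (A : Type) := gen_choiceMixin (fps A).

Section FormalPowerSeries.
Variable A : comNzRingType.
Implicit Types f g h : fps A.

Lemma fpsP f g : (forall n, fps_coef f n = fps_coef g n) -> f = g.
Proof. by case: f g => [f] [g] /= /funext ->. Qed.

Definition fpsC (a : A) : fps A := Fps (fun n => if n == 0%N then a else 0).
Definition fpsT : fps A := Fps (fun n => (n == 1%N)%:R).

Definition fps_add f g := Fps (fun n => fps_coef f n + fps_coef g n).
Definition fps_opp f := Fps (fun n => - fps_coef f n).
Definition fps_mul f g :=
  Fps (fun n => \sum_(i < n.+1) fps_coef f i * fps_coef g (n - i)%N).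

Let fps_addA : associative fps_add.
Proof. by move=> f g h; apply: fpsP => n /=; rewrite addrA. Qed.
Let fps_addC : commutative fps_add.
Proof. by move=> f g; apply: fpsP => n /=; rewrite addrC. Qed.
Let fps_add0 : left_id (fpsC 0) fps_add.
Proof. by move=> f; apply: fpsP => n /=; rewrite if_same add0r. Qed.
Let fps_addN : left_inverse (fpsC 0) fps_opp fps_add.
Proof. by move=> f; apply: fpsP => n /=; rewrite if_same addNr. Qed.

HB.instance Definition _ :=
  GRing.isZmodule.Build (fps A) fps_addA fps_addC fps_add0 fps_addN.

Let trunc N f : {poly A} := \poly_(i < N) fps_coef f i.

Let coef_mul_trunc N f g n : (n < N)%N ->
  fps_coef (fps_mul f g) n = (trunc N f * trunc N g)`_n.
Proof.
move=> nN; rewrite coefM /=; apply: eq_bigr => i _.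
by rewrite !coef_poly (leq_ltn_trans (leq_subr _ _) nN) (leq_ltn_trans _ nN) // -ltnS.
Qed.

Let fps_mulC : commutative fps_mul.
Proof.
by move=> f g; apply: fpsP => n; rewrite !(@coef_mul_trunc n.+1) // mulrC.
Qed.

Let fps_mulA : associative fps_mul.
Proof.
move=> f g h; apply: fpsP => n.
transitivity (trunc n.+1 f * (trunc n.+1 g * trunc n.+1 h))`_n.
  rewrite coefM /=; apply: eq_bigr => i _; rewrite coef_poly ltn_ord; congr (_ * _).
  by rewrite -(@coef_mul_trunc n.+1) // ltnS leq_subr.
rewrite mulrA coefM /=; apply: eq_bigr => i _.
rewrite coef_poly ltnS leq_subr; congr (_ * _).
by rewrite -(@coef_mul_trunc n.+1).
Qed.

Let fps_mul1 : left_id (fpsC 1) fps_mul.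
Proof.
move=> f; apply: fpsP => n /=; rewrite big_ord_recl /= mul1r subn0 big1 ?addr0 //.
by move=> i _; rewrite mul0r.
Qed.

Let fps_mulD : left_distributive fps_mul fps_add.
Proof.
move=> f g h; apply: fpsP => n /=; rewrite -big_split /=.
by apply: eq_bigr => i _; rewrite mulrDl.
Qed.

Let fps1_neq0 : fpsC 1 != 0.
Proof. by apply/eqP => -[] /(congr1 (@^~ 0%N)) /= /eqP; rewrite oner_eq0. Qed.

HB.instance Definition _ := GRing.Zmodule_isComNzRing.Build (fps A)
  fps_mulA fps_mulC fps_mul1 fps_mulD fps1_neq0.

(* The inverse of f when it exists, and f otherwise. *)
Definition fps_unit : {pred fps A} := fun f => `[< exists g, g * f = 1 >].
Definition fps_inv f : fps A := classical_sets.xget f (fun g => g * f = 1).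

Let fps_mulV : {in fps_unit, left_inverse 1 fps_inv *%R}.
Proof. by move=> f /asboolP [g gf1]; rewrite /fps_inv; case: classical_sets.xgetP => // /(_ g). Qed.

Let fps_unitPl f g : g * f = 1 -> fps_unit f.
Proof. by move=> gf1; apply/asboolP; exists g. Qed.

Let fps_inv_out : {in [predC fps_unit], fps_inv =1 id}.
Proof.
move=> f /asboolPn nuf; rewrite /fps_inv; case: classical_sets.xgetP => // g _ gf1.
by case: nuf; exists g.
Qed.

HB.instance Definition _ :=
  GRing.ComNzRing_hasMulInverse.Build (fps A) fps_mulV fps_unitPl fps_inv_out.

Lemma fps_1BT_unit : (1 - fpsT) \is a GRing.unit.
Proof.
apply: (@fps_unitPl _ (Fps (fun=> 1))); apply: fpsP => n.
rewrite mulrC /=; case: n => [|n]; first by rewrite big_ord1 /= subr0 mulr1.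
rewrite !big_ord_recl /= big1 => [|i _]; last by rewrite /= subr0 mul0r.
by rewrite subr0 sub0r !mulr1 addr0 subrr.
Qed.

End FormalPowerSeries.

Arguments fpsT {A}.

(* Ordinary generating function, in the ring A[[t]], of a sequence in A. *)
Definition ogf (A : comNzRingType) (u : nat -> A) : fps A := Fps u.

(* Main.v *)
Require Import Defs.
From HB Require Import structures.
From mathcomp Require Import all_boot all_order all_algebra.
From mathcomp Require Import all_classical all_reals all_analysis.
From mathcomp Require Import complex ring.
Import Order.TTheory GRing.Theory Num.Theory.
Import numFieldNormedType.Exports.
Local Open Scope classical_set_scope.
Local Open Scope ring_scope.

(** Comparing the two sides power by power in [x], the identity reduces to one
    series for each exponent, obtained from the negative binomial series
    [\sum_r (r+1)(r+2)...(r+k) t^r = k! / (1-t)^(k+1)].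
    Since [(r)_{k+1}] vanishes at [r = 0], shifting the index turns it into
    [\sum_r (r)_{k+1} t^r = t (k+1)! / (1-t)^(k+2)], and the sum of these against
    [S(n,k+1) x^(k+1)] is the right-hand side expanded in powers of [x]
    ([omega_divE]).  The index [k = 0] contributes nothing because [S(n,0) = 0]
    for [n > 0]; for [n = 0] the identity fails, as the left-hand side would then
    be [1/(1-t)] and the right-hand side [t/(1-t)].

    The negative binomial series is computed by induction on [k] from the
    difference equation [(r+1)_{k+1} - (r)_{k+1} = (k+1) (r+1)_k]
    ([rising_fact_diff]), which says that multiplying the series for [k+1] by
    [1-t] gives [k+1] times the series for [k].  In the ring of formal power
    series this is the whole proof ([ogf_rising_factS]).

    For complex [t] in the open unit disc the same computation is made on partial
    sums, where it leaves the remainder [(m)_{k+1} t^m] ([rising_seriesS]).  To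
    see that this tends to [0], take [t] real and nonnegative: dropping the
    remainder, which is then nonnegative, bounds the partial sums by the expected
    limit, so the series converges by monotonicity and its general term vanishes
    in the limit ([cvg_rising_fact_expr_real]).  A complex [t] follows by taking
    norms. *)

(** * Rising factorials and Stirling numbers *)

Lemma rising_fact0 r : rising_fact r 0 = 1%N.
Proof. by rewrite /rising_fact big_ord0. Qed.

Lemma rising_fact_recl r k :
  rising_fact r k.+1 = (r * rising_fact r.+1 k)%N.
Proof.
rewrite /rising_fact big_ord_recl addn0; congr (_ * _)%N.
by apply: eq_bigr => i _; rewrite addSnnS.
Qed.

Lemma rising_fact_recr r k :
  rising_fact r k.+1 = (rising_fact r k * (r + k))%N.
Proof. by rewrite /rising_fact big_ord_recr. Qed.

(** The two terms of the difference share the factor [(r+1)_k]: one has the extra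
    factor [r+1+k], the other the extra factor [r]. *)
Lemma rising_fact_diff r k :
  rising_fact r.+1 k.+1 = (rising_fact r k.+1 + k.+1 * rising_fact r.+1 k)%N.
Proof.
by rewrite [LHS]rising_fact_recr rising_fact_recl -mulnDl addSnnS mulnC.
Qed.

Lemma stirling2_0r n : (0 < n)%N -> stirling2 n 0 = 0%N.
Proof.
case: n => // n _; apply/eqP; rewrite cards_eq0; apply/eqP/setP => P.
rewrite !inE cards_eq0; apply/negP => /andP[/and3P[/eqP covP _ _] /eqP P0].
by have := finset.in_setT (@ord0 n); rewrite -covP P0 /finset.cover big_set0 inE.
Qed.

(** Removing the index [0], where [stirling2 n 0 = 0], leaves only rising factorials
    that vanish at [r = 0], so that their series in [r] can be shifted. *)
Lemma geom_poly_recl (A : nzRingType) n r (x : A) : (0 < n)%N ->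
  (geom_poly A n r).[x] =
  \sum_(k < n) (stirling2 n k.+1)%:R * (rising_fact r k.+1)%:R * x ^+ k.+1.
Proof.
move=> n0; rewrite geom_polyE big_mkord big_ord_recl stirling2_0r // !mul0r.
by rewrite add0r.
Qed.

(** The right-hand side as a combination of the series [t (k+1)! / (1-t)^(k+2)];
    this common form serves both the formal and the analytic statement. *)
Lemma omega_divE (A : comUnitRingType) n (x t : A) : (0 < n)%N ->
  t / (1 - t) * (omega A n).[x / (1 - t)] =
  \sum_(k < n) (stirling2 n k.+1)%:R * x ^+ k.+1
               * (t * (k.+1`!%:R / (1 - t) ^+ k.+2)).
Proof.
move=> n0; rewrite /omega geom_poly_recl // mulr_sumr; apply: eq_bigr => k _.
rewrite rising_fact1 exprMn exprVn; set c := _%:R; set f := _%:R.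
rewrite -!exprVn (exprS _ k.+1); set v := (1 - t)^-1; set y := x ^+ _.
set w := v ^+ _; by ring.
Qed.

(** * The identity for formal power series *)

Section Formal.
Variable A : comNzRingType.
Implicit Types (f g : fps A).

Lemma fps_coefM f g m :
  fps_coef (f * g) m = \sum_(i < m.+1) fps_coef f i * fps_coef g (m - i)%N.
Proof. by []. Qed.

Lemma fps_coef_sum (I : Type) (s : seq I) (F : I -> fps A) m :
  fps_coef (\sum_(i <- s) F i) m = \sum_(i <- s) fps_coef (F i) m.
Proof.
apply: (big_morph (fun f : fps A => fps_coef f m)) => //=.
by rewrite if_same.
Qed.

Lemma fps_coefCM (a : A) f m : fps_coef (fpsC a * f) m = a * fps_coef f m.
Proof.
rewrite fps_coefM big_ord_recl big1 ?addr0 ?subn0 // => i _.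
by rewrite mul0r.
Qed.

Lemma fps_coefMn f j m : fps_coef (f *+ j) m = fps_coef f m *+ j.
Proof.
elim: j => [|j IHj]; first by rewrite !mulr0n /= if_same.
by rewrite !mulrS /= IHj.
Qed.

Lemma fpsCX (a : A) j : fpsC a ^+ j = fpsC (a ^+ j).
Proof.
elim: j => // j IHj; rewrite !exprS IHj; apply: fpsP => m.
by rewrite fps_coefCM /=; case: eqP; rewrite ?mulr0.
Qed.

Lemma fps_coefTM f m :
  fps_coef (fpsT * f) m = if m is m'.+1 then fps_coef f m' else 0.
Proof.
rewrite fps_coefM big_ord_recl /= mul0r add0r.
case: m => [|m]; first by rewrite big_ord0.
rewrite big_ord_recl big1 ?addr0 => [|i _]; last by rewrite /= mul0r.
by rewrite /= mul1r subSS subn0.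
Qed.

Lemma fps_coef_1BTM f m :
  fps_coef ((1 - fpsT) * f) m =
  fps_coef f m - (if m is m'.+1 then fps_coef f m' else 0).
Proof. by rewrite mulrBl mul1r -fps_coefTM. Qed.

(** The coefficients of [1 - fpsT] times a series are the differences of its
    coefficients, so [rising_fact_diff] is the induction step. *)
Lemma ogf_rising_factS k :
  ogf (fun r => (rising_fact r.+1 k)%:R : A) = k`!%:R / (1 - fpsT) ^+ k.+1.
Proof.
have U j : (1 - fpsT : fps A) ^+ j \is a GRing.unit by rewrite unitrX ?fps_1BT_unit.
elim: k => [|k IHk].
  apply: (canRL (mulrK (U 1))); rewrite expr1 mulrC; apply: fpsP => m.
  rewrite fps_coef_1BTM /=; case: m => [|m]; by rewrite !rising_fact0 ?subr0 ?subrr.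
apply: (canRL (mulrK (U k.+2))); rewrite exprS mulrA.
rewrite [_ * (1 - fpsT)]mulrC.
suff -> : (1 - fpsT) * ogf (fun r => (rising_fact r.+1 k.+1)%:R : A) =
          ogf (fun r => (rising_fact r.+1 k)%:R) *+ k.+1.
  by rewrite IHk -mulrnAl divrK // factS natrM mulr_natl.
apply: fpsP => m; rewrite fps_coef_1BTM fps_coefMn /= rising_fact_diff.
rewrite natrD natrM mulr_natl addrC.
by case: m => [|m]; rewrite ?addKr ?addrK // addrC rising_fact_recl mul0n add0r subr0.
Qed.

Lemma ogf_geom_poly n (x : A) : (0 < n)%N ->
  ogf (fun r : nat => (geom_poly A n r).[x]) =
  fpsT / (1 - fpsT) * (omega (fps A) n).[fpsC x / (1 - fpsT)].
Proof.
move=> n0; rewrite omega_divE //; apply: fpsP => r.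
rewrite fps_coef_sum [LHS]geom_poly_recl //; apply: eq_bigr => k _.
rewrite -ogf_rising_factS fpsCX [in RHS]mulr_natl [in RHS]mulrnAl fps_coefMn.
rewrite fps_coefCM fps_coefTM -mulrA [LHS]mulr_natl mulrC; congr (_ * _ *+ _).
by case: r => [|r] //; rewrite rising_fact_recl mul0n.
Qed.

End Formal.

(** * Convergence in the unit disc *)

(** Summation by parts against the difference equation; the remainder is what
    telescoping leaves at the upper end, the lower end being [(0)_{k+1} = 0]. *)
Lemma rising_seriesS (K : comNzRingType) (t : K) k m :
  (1 - t) * \sum_(0 <= r < m) (rising_fact r.+1 k.+1)%:R * t ^+ r =
  k.+1%:R * (\sum_(0 <= r < m) (rising_fact r.+1 k)%:R * t ^+ r)
  - (rising_fact m k.+1)%:R * t ^+ m.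
Proof.
elim: m => [|m IHm].
  by rewrite !big_nil rising_fact_recl mul0n mul0r !mulr0 subr0.
rewrite !big_nat_recr //= !mulrDr IHm rising_fact_diff natrD natrM exprS.
by ring.
Qed.

Lemma rising_series0 (K : comNzRingType) (t : K) m :
  (1 - t) * \sum_(0 <= r < m) (rising_fact r.+1 0)%:R * t ^+ r = 1 - t ^+ m.
Proof.
elim: m => [|m IHm]; first by rewrite big_nil mulr0 subrr.
rewrite big_nat_recr //= mulrDr IHm rising_fact0 exprS; by ring.
Qed.

(** For nonnegative [s] the remainders have a favourable sign, so that the limit
    of the series is an upper bound before convergence is known. *)
Lemma rising_series_le (R : realType) (s : R) k m : 0 <= s < 1 ->
  \sum_(0 <= r < m) (rising_fact r.+1 k)%:R * s ^+ r <= k`!%:R / (1 - s) ^+ k.+1.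
Proof.
move=> /andP[s0 s1]; have s1' : 0 < 1 - s by rewrite subr_gt0.
elim: k => [|k IHk].
  by rewrite ler_pdivlMr ?exprn_gt0 // expr1 mulrC rising_series0 lerBlDr lerDl exprn_ge0.
rewrite factS natrM exprS invfM mulrCA ler_pdivlMl // rising_seriesS.
rewrite lerBlDr (le_trans (ler_wpM2l _ IHk)) // ?mulrA ?lerDl ?mulr_ge0 ?exprn_ge0 //.
Qed.

(** The terms of a convergent series tend to [0]: this avoids comparing the growth
    of polynomials and exponentials. *)
Lemma cvg_rising_fact_expr_real (R : realType) (s : R) k : 0 <= s < 1 ->
  (fun m => (rising_fact m k)%:R * s ^+ m : R^o) @ \oo --> (0 : R^o).
Proof.
move=> s01; have /andP[s0 s1] := s01.
have term_ge0 r : 0 <= (rising_fact r.+1 k)%:R * s ^+ r by rewrite mulr_ge0 ?exprn_ge0.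
have : cvgn (series (fun r => (rising_fact r.+1 k)%:R * s ^+ r : R^o)).
  apply: nondecreasing_is_cvgn; first by apply: nondecreasing_series => *; apply: term_ge0.
  exists (k`!%:R / (1 - s) ^+ k.+1) => _ [m _ <-]; exact: rising_series_le.
move=> /cvg_series_cvg_0 term0.
(* Up to the factor [s], the shifted sequence is the general term of that series. *)
set u := (X in X @ _ --> _).
suff : [sequence u m.+1]_m @ \oo --> (0 : R^o) by rewrite cvg_shiftS.
have -> : [sequence u m.+1]_m = (fun m => s * ((rising_fact m.+1 k)%:R * s ^+ m)).
  by apply/funext => m; rewrite /u /= exprS mulrCA.
by rewrite -(mulr0 s); exact: cvgMl_tmp term0.
Qed.

(** A norm in [R[i]] is the embedding of a real number, so the real case applied
    to the norm of [t] suffices. *)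
Lemma cvg_rising_fact_expr_complex (R : realType) (t : R[i]) k : `|t| < 1 ->
  (fun m => (rising_fact m k)%:R * t ^+ m : R[i]^o) @ \oo --> (0 : R[i]^o).
Proof.
move=> t1; have tE : `|t| = (complex.Re `|t|)%:C%C by rewrite RRe_real ?normr_real.
set s := complex.Re `|t| in tE.
have s01 : 0 <= s < 1 by rewrite -(lecR 0) -(ltcR s 1) -tE t1 normr_ge0.
apply/cvgr0Pnorm_lt => e e0.
have eE : e = (complex.Re e)%:C%C by rewrite RRe_real ?gtr0_real.
have Re0 : 0 < complex.Re e by rewrite -(ltcR 0) -eE.
have /cvgr0Pnorm_lt/(_ _ Re0) := cvg_rising_fact_expr_real R s k s01.
apply: filterS => m; have /andP[s0 _] := s01.
rewrite ger0_norm ?mulr_ge0 ?exprn_ge0 // => ms.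
rewrite normrM normrX normr_nat tE eE.
by rewrite -rmorphXn -(rmorph_nat (real_complex R)) -rmorphM /= ltcR.
Qed.

(** Passing to the limit in the recurrence for partial sums. The decay of the
    remainders is a hypothesis because an abstract [K] need not be archimedean, in
    which case [t ^+ m] may fail to tend to [0]. *)
Lemma cvg_rising_series (K : numFieldType) (t : K) : 1 - t != 0 ->
  (forall k, (fun m => (rising_fact m k)%:R * t ^+ m : K^o) @ \oo --> (0 : K^o)) ->
  forall k, series (fun r => (rising_fact r.+1 k)%:R * t ^+ r : K^o) @ \oo
    --> (k`!%:R / (1 - t) ^+ k.+1 : K^o).
Proof.
move=> t1 t0; elim=> [|k IHk].
  have -> : series (fun r => (rising_fact r.+1 0)%:R * t ^+ r : K^o) =
      (fun m => (1 - (rising_fact m 0)%:R * t ^+ m) * (1 - t)^-1).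
    apply/funext => m; rewrite /series /=; apply: (canRL (mulfK t1)).
    by rewrite mulrC rising_series0 rising_fact0 mul1r.
  have -> : 0`!%:R / (1 - t) ^+ 1 = (1 - 0) * (1 - t)^-1 by rewrite subr0 expr1.
  apply: cvgMr_tmp; apply: (cvgB (V := K^o)); [exact: cvg_cst|exact: t0].
have -> : series (fun r => (rising_fact r.+1 k.+1)%:R * t ^+ r : K^o) =
    (fun m => (k.+1%:R * series (fun r => (rising_fact r.+1 k)%:R * t ^+ r : K^o) m
               - (rising_fact m k.+1)%:R * t ^+ m) * (1 - t)^-1).
  apply/funext => m; rewrite /series /=; apply: (canRL (mulfK t1)).
  by rewrite mulrC rising_seriesS.
have -> : k.+1`!%:R / (1 - t) ^+ k.+2 =
    (k.+1%:R * (k`!%:R / (1 - t) ^+ k.+1) - 0) * (1 - t)^-1.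
  by rewrite subr0 factS natrM exprSr invfM !mulrA.
apply: cvgMr_tmp; apply: (cvgB (V := K^o)); last exact: t0.
exact: cvgMl_tmp.
Qed.

Lemma cvg_power_series_shift (K : numFieldType) (u : nat -> K) (t l : K) :
  u 0%N = 0 ->
  series (fun r => u r.+1 * t ^+ r : K^o) @ \oo --> (l : K^o) ->
  series (fun r => u r * t ^+ r : K^o) @ \oo --> (t * l : K^o).
Proof.
move=> u0 cl; set p := series _.
suff : [sequence p m.+1]_m @ \oo --> (t * l : K^o) by rewrite cvg_shiftS.
have -> : [sequence p m.+1]_m =
    (fun m => t * series (fun r => u r.+1 * t ^+ r : K^o) m).
  apply/funext => m; rewrite /p /series /= big_nat_recl // u0 mul0r add0r mulr_sumr.
  by apply: eq_bigr => r _; rewrite exprS mulrCA.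
exact: cvgMl_tmp.
Qed.

Lemma cvg_series_geom_poly (K : numFieldType) n (x t : K) : (0 < n)%N ->
  1 - t != 0 ->
  (forall k, (fun m => (rising_fact m k)%:R * t ^+ m : K^o) @ \oo --> (0 : K^o)) ->
  series (fun r => (geom_poly K n r).[x] * t ^+ r : K^o) @ \oo -->
  (t / (1 - t) * (omega K n).[x / (1 - t)] : K^o).
Proof.
move=> n0 t1 t0; rewrite omega_divE //.
have -> : series (fun r => (geom_poly K n r).[x] * t ^+ r : K^o) =
  (fun m => \sum_(k < n) (stirling2 n k.+1)%:R * x ^+ k.+1
     * series (fun r => (rising_fact r k.+1)%:R * t ^+ r : K^o) m).
  apply/funext => m; rewrite /series /=.
  under eq_bigr do rewrite geom_poly_recl // mulr_suml.
  rewrite exchange_big; apply: eq_bigr => k _ /=; rewrite mulr_sumr.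
  by apply: eq_bigr => r _; rewrite mulrA [in RHS](mulrAC _ (x ^+ _)).
apply: (cvg_big (U := K^o)) => [|k _]; first exact: add_continuous.
apply: cvgMl_tmp.
apply: (cvg_power_series_shift _ (fun r => (rising_fact r k.+1)%:R)).
  by rewrite rising_fact_recl mul0n.
exact: cvg_rising_series.
Qed.

Theorem proposition3 (n : nat) (n_gt0 : (0 < n)%N) :
  (forall (A : comNzRingType) (x : A),
     ogf (fun r : nat => (geom_poly A n r).[x]) =
     fpsT / (1 - fpsT) * (omega (fps A) n).[fpsC x / (1 - fpsT)])
  /\
  (forall (R : realType) (x t : R[i]), `|t| < 1 ->
     series (fun r : nat => (geom_poly R[i] n r).[x] * t ^+ r : R[i]^o) @ \oo -->
     (t / (1 - t) * (omega R[i] n).[x / (1 - t)] : R[i]^o)).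
Proof.
split=> [A x|R x t t1]; first exact: ogf_geom_poly.
apply: cvg_series_geom_poly => // [|k]; last exact: cvg_rising_fact_expr_complex.
by apply: contraTneq t1 => /subr0_eq <-; rewrite normr1 ltxx.
Qed.
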